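(* Let $n\ge 1$, $q\in\mathbb C^*$, let $A$ be the $n\times n$ matrix with all entries $a_{i,j}=1$, and let $\lambda_a=q^a$, $\mu_b=q^b$ for all $a,b\in\mathbb Z$. Then $$|A|_{\lambda,\mu}=\prod_{m=1}^{\lfloor n/2\rfloor}\ \prod_{j=2m-n}^{n-2m}(1+q^j).$$
   Context: Generalized Lambda-determinant: given $A=(a_{r,c})_{1\le r,c\le n}$ and parameters $(\lambda_a),(\mu_a)$, define $T_{i,j,k}$ for $i,j\in\mathbb Z$, $k\ge 0$, $i+j+k\equiv n \pmod 2$, by $T_{i,j,0}=1$ ($i+j\equiv n$ mod 2), $T_{i,j,1}=a_{\frac{j-i+n+1}{2},\frac{i+j+n+1}{2}}$ ($i+j\equiv n+1$ mod 2, $|i|+|j|\le n-1$), and $T_{i,j,k+1}T_{i,j,k-1}=\mu_j\,T_{i,j+1,k}T_{i,j-1,k}+\lambda_i\,T_{i+1,j,k}T_{i-1,j,k}$. Then $|A|_{\lambda,\mu}:=T_{0,0,n}$ (determined by the data with $|i|+|j|\le n-1$). *)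

(* Defs.v *)
From mathcomp Require Import all_boot all_order all_algebra.
From mathcomp Require Import fraction mpoly complex reals zify.

Set Implicit Arguments.
Unset Strict Implicit.
Unset Printing Implicit Defensive.

Import Order.TTheory GRing.Theory Num.Theory.

Local Open Scope ring_scope.

(* 1-based access to the entry a_{r,c}.  The default value 1 is only used for
   (r, c) outside [1, n]^2, where the T-system has no prescribed datum. *)
Definition entry (K : fieldType) (n : nat) (A : 'M[K]_n) (r c : int) : K :=
  match insub (absz (r - 1)), insub (absz (c - 1)) with
  | Some r', Some c' => A r' c'
  | _, _ => 1
  end.

(* T_{i,j,k}, with the recurrence solved for T_{i,j,k+1}.  Only the values with
   i + j + k = n mod 2 and |i| + |j| + k <= n are meaningful (and these only
   involve one another); the others are arbitrary.  The division is harmless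
   where Tsys is used below, namely for generic data: see Tgen_neq0 and
   Tgen_recurrence. *)
Fixpoint Tsys (K : fieldType) (n : nat) (A : 'M[K]_n) (lam mu : int -> K)
    (i j : int) (k : nat) {struct k} : K :=
  match k with
  | 0 => 1
  | 1 => entry A ((j - i + n%:Z + 1) %/ 2)%Z ((i + j + n%:Z + 1) %/ 2)%Z
  | (k'.+1 as k1).+1 =>
      (mu j * Tsys A lam mu i (j + 1) k1 * Tsys A lam mu i (j - 1) k1
       + lam i * Tsys A lam mu (i + 1) j k1 * Tsys A lam mu (i - 1) j k1)
      / Tsys A lam mu i j k'
  end.

Lemma TsysSS (K : fieldType) (n : nat) (A : 'M[K]_n) (lam mu : int -> K)
    (i j : int) (k : nat) :
  Tsys A lam mu i j k.+2 =
    (mu j * Tsys A lam mu i (j + 1) k.+1 * Tsys A lam mu i (j - 1) k.+1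
     + lam i * Tsys A lam mu (i + 1) j k.+1 * Tsys A lam mu (i - 1) j k.+1)
    / Tsys A lam mu i j k.
Proof. by []. Qed.

(* Names of the independent data: the entries a_{r,c}, and the parameters
   lambda_a, mu_a with |a| <= n, where a is stored as a + n.  (T_{0,0,n} only
   involves those with |a| <= n - 2.) *)
Definition datum (n : nat) : finType :=
  ('I_n * 'I_n + ('I_n.*2.+1 + 'I_n.*2.+1))%type.

Notation genpoly C n := {mpoly C[#|datum n|]}.
Notation genfrac C n := {fraction genpoly C n}.

Definition gen (C : fieldType) (n : nat) (d : datum n) : genfrac C n :=
  FracField.tofrac ('X_(enum_rank d) : genpoly C n).

Definition gen_mx (C : fieldType) (n : nat) : 'M[genfrac C n]_n :=
  \matrix_(r, c) gen C (inl (r, c) : datum n).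

Definition gen_lam (C : fieldType) (n : nat) (a : int) : genfrac C n :=
  gen C (inr (inl (inord (absz (a + n%:Z)))) : datum n).

Definition gen_mu (C : fieldType) (n : nat) (a : int) : genfrac C n :=
  gen C (inr (inr (inord (absz (a + n%:Z)))) : datum n).

Definition Tgen (C : fieldType) (n : nat) (i j : int) (k : nat) : genfrac C n :=
  Tsys (gen_mx C n) (@gen_lam C n) (@gen_mu C n) i j k.

Definition datum_val (C : fieldType) (n : nat) (A : 'M[C]_n)
    (lam mu : int -> C) (d : datum n) : C :=
  match d with
  | inl (r, c) => A r c
  | inr (inl a) => lam (a%:Z - n%:Z)
  | inr (inr a) => mu (a%:Z - n%:Z)
  end.

Definition data_point (C : fieldType) (n : nat) (A : 'M[C]_n)
    (lam mu : int -> C) (t : 'I_#|datum n|) : C :=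
  datum_val A lam mu (enum_val t).

(* The rational function f is regular at x, with value v there. *)
Definition specializes (C : fieldType) (N : nat) (x : 'I_N -> C)
    (f : {fraction {mpoly C[N]}}) (v : C) : Prop :=
  exists num den : {mpoly C[N]},
    [/\ den.@[x] != 0,
        f = FracField.tofrac num / FracField.tofrac den
      & v = num.@[x] / den.@[x]].

(* |A|_{lambda,mu} = v.  T_{0,0,n} is a rational function of the data (in fact
   Laurent polynomial in the entries, polynomial in the parameters), and
   |A|_{lambda,mu} is its value at the given data.  Running the recurrence on
   the given data itself may meet a division 0/0 (e.g. all entries 1,
   lambda_a = mu_a = (-1)^a, n = 5); when it does not, both procedures agree:
   see is_lambda_det_direct. *)
Definition is_lambda_det (C : fieldType) (n : nat) (A : 'M[C]_n)
    (lam mu : int -> C) (v : C) : Prop :=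
  specializes (data_point A lam mu) (Tgen C n 0 0 n) v.

(* The increasing list of the integers j with a <= j <= b. *)
Definition zrange (a b : int) : seq int :=
  if a <= b then [seq a + t%:Z | t <- iota 0 (absz (b - a)).+1] else [::].

Lemma zrange_uniq (a b : int) : uniq (zrange a b).
Proof.
rewrite /zrange; case: ifP => // _; rewrite map_inj_uniq ?iota_uniq //.
by move=> x y /addrI [].
Qed.

Lemma mem_zrange (a b j : int) : (j \in zrange a b) = (a <= j <= b).
Proof.
rewrite /zrange; case: ifP => [leab|/negbT]; last by rewrite in_nil; lia.
apply/mapP/idP => [[t]|/andP[leaj lejb]].
  by rewrite mem_iota => ht ->; lia.
by exists (absz (j - a)); rewrite ?mem_iota; lia.
Qed.

Lemma specializes_unique (C : fieldType) (N : nat) (x : 'I_N -> C)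
    (f : {fraction {mpoly C[N]}}) (v w : C) :
  specializes x f v -> specializes x f w -> v = w.
Proof.
move=> [p [q [q0 -> ->]]] [p' [q' [q'0 e ->]]].
have nz (s : {mpoly C[N]}) : s.@[x] != 0 -> FracField.tofrac s != 0.
  by move=> s0; rewrite tofrac_eq0; apply: contraNneq s0 => ->; rewrite meval0.
move/eqP: e; rewrite eqr_div ?nz // -!tofracM tofrac_eq => /eqP e.
by apply/eqP; rewrite eqr_div // -!mevalM e.
Qed.

Lemma is_lambda_det_unique (C : fieldType) (n : nat) (A : 'M[C]_n)
    (lam mu : int -> C) (v w : C) :
  is_lambda_det A lam mu v -> is_lambda_det A lam mu w -> v = w.
Proof. exact: specializes_unique. Qed.

Lemma specializes_tofrac (C : fieldType) (N : nat) (x : 'I_N -> C)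
    (p : {mpoly C[N]}) : specializes x (FracField.tofrac p) p.@[x].
Proof.
by exists p, 1; rewrite meval1 tofrac1 !divr1 oner_neq0.
Qed.

Lemma specializes_neq0 (C : fieldType) (N : nat) (x : 'I_N -> C)
    (f : {fraction {mpoly C[N]}}) (v : C) :
  specializes x f v -> v != 0 -> f != 0.
Proof.
move=> sf; apply: contraNneq => f0.
have := specializes_tofrac x 0; rewrite tofrac0 meval0 -f0.
by move/(specializes_unique sf) => ->.
Qed.

Lemma specializesD (C : fieldType) (N : nat) (x : 'I_N -> C)
    (f g : {fraction {mpoly C[N]}}) (v w : C) :
  specializes x f v -> specializes x g w -> specializes x (f + g) (v + w).
Proof.
move=> [p [q [q0 -> ->]]] [p' [q' [q'0 -> ->]]].
have nz (s : {mpoly C[N]}) : s.@[x] != 0 -> FracField.tofrac s != 0.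
  by move=> s0; rewrite tofrac_eq0; apply: contraNneq s0 => ->; rewrite meval0.
exists (p * q' + p' * q), (q * q'); rewrite mevalM mulf_neq0 //; split=> //.
  by rewrite tofracD !tofracM addf_div ?nz.
by rewrite mevalD !mevalM addf_div.
Qed.

Lemma specializesM (C : fieldType) (N : nat) (x : 'I_N -> C)
    (f g : {fraction {mpoly C[N]}}) (v w : C) :
  specializes x f v -> specializes x g w -> specializes x (f * g) (v * w).
Proof.
move=> [p [q [q0 -> ->]]] [p' [q' [q'0 -> ->]]].
exists (p * p'), (q * q').
by rewrite !mevalM mulf_neq0 // !tofracM !mulf_div.
Qed.

Lemma specializesV (C : fieldType) (N : nat) (x : 'I_N -> C)
    (f : {fraction {mpoly C[N]}}) (v : C) :
  v != 0 -> specializes x f v -> specializes x f^-1 v^-1.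
Proof.
move=> v0 [p [q [q0 ef ev]]]; exists q, p; rewrite ef ev !invf_div; split=> //.
by apply: contraNneq v0 => p0; rewrite ev p0 mul0r.
Qed.

Lemma specializes_gen (C : fieldType) (n : nat) (A : 'M[C]_n)
    (lam mu : int -> C) (d : datum n) :
  specializes (data_point A lam mu) (gen C d) (datum_val A lam mu d).
Proof.
have -> : datum_val A lam mu d =
    ('X_(enum_rank d) : genpoly C n).@[data_point A lam mu].
  by rewrite mevalXU /data_point enum_rankK.
exact: specializes_tofrac.
Qed.

Lemma Tgen_specializes (C : fieldType) (n : nat) (A : 'M[C]_n)
    (lam mu : int -> C) :
    (forall (i j : int) (k : nat), (`|i| + `|j| + k.+2 <= n)%N ->
       Tsys A lam mu i j k != 0) ->
  forall (i j : int) (k : nat), (`|i| + `|j| + k <= n)%N ->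
    specializes (data_point A lam mu) (Tgen C n i j k) (Tsys A lam mu i j k).
Proof.
move=> nz i j k; elim/ltn_ind: k i j => -[|[|k]] IH i j hk.
- rewrite /Tgen /= -tofrac1 -[X in specializes _ _ X](meval1 (data_point A lam mu)).
  exact: specializes_tofrac.
- rewrite /Tgen /= /entry.
  have h1 : specializes (data_point A lam mu) 1 1.
    rewrite -tofrac1 -[X in specializes _ _ X](meval1 (data_point A lam mu)).
    exact: specializes_tofrac.
  case: insub => [r|//]; case: insub => [c|//].
  by rewrite mxE; apply: specializes_gen.
have glam : specializes (data_point A lam mu) (gen_lam C n i) (lam i).
  have -> : lam i = datum_val A lam mu
      (inr (inl (inord (absz (i + n%:Z)))) : datum n).
    by rewrite /= inordK; [congr lam; lia | lia].
  exact: specializes_gen.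
have gmu : specializes (data_point A lam mu) (gen_mu C n j) (mu j).
  have -> : mu j = datum_val A lam mu
      (inr (inr (inord (absz (j + n%:Z)))) : datum n).
    by rewrite /= inordK; [congr mu; lia | lia].
  exact: specializes_gen.
have sT i' j' k' (hk' : (k' < k.+2)%N) (h : (`|i'| + `|j'| + k' <= n)%N) :
    specializes (data_point A lam mu)
      (Tsys (gen_mx C n) (@gen_lam C n) (@gen_mu C n) i' j' k')
      (Tsys A lam mu i' j' k') by apply: IH.
rewrite /Tgen !TsysSS; apply: specializesM.
  apply: specializesD; (apply: specializesM; first apply: specializesM) => //;
  by apply: sT; lia.
by apply: specializesV; [apply: nz | apply: sT]; lia.
Qed.

Lemma is_lambda_det_direct (C : fieldType) (n : nat) (A : 'M[C]_n)
    (lam mu : int -> C) :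
    (forall (i j : int) (k : nat), (`|i| + `|j| + k.+2 <= n)%N ->
       Tsys A lam mu i j k != 0) ->
  is_lambda_det A lam mu (Tsys A lam mu 0 0 n).
Proof. by move=> nz; apply: Tgen_specializes. Qed.

Lemma Tgen_neq0 (C : numFieldType) (n : nat) (i j : int) (k : nat) :
  (`|i| + `|j| + k <= n)%N -> Tgen C n i j k != 0.
Proof.
pose A : 'M[C]_n := const_mx 1; pose u (_ : int) : C := 1.
have pos i' j' k' : 0 < Tsys A u u i' j' k'.
  elim/ltn_ind: k' i' j' => -[|[|k']] IH i' j'; first exact: ltr01.
    by rewrite /= /entry; case: insub => [?|]; first case: insub => [?|];
      rewrite ?mxE ltr01.
  by rewrite TsysSS /u !mul1r divr_gt0 ?addr_gt0 ?mulr_gt0 ?IH.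
move=> h; have nz i' j' k' : Tsys A u u i' j' k' != 0 by rewrite gt_eqF.
exact: specializes_neq0 (Tgen_specializes (fun i' j' k' _ => nz i' j' k') h)
  (nz _ _ _).
Qed.

Lemma Tgen_recurrence (C : numFieldType) (n : nat) (i j : int) (k : nat) :
  (`|i| + `|j| + k.+2 <= n)%N ->
  Tgen C n i j k.+2 * Tgen C n i j k =
    gen_mu C n j * Tgen C n i (j + 1) k.+1 * Tgen C n i (j - 1) k.+1
  + gen_lam C n i * Tgen C n (i + 1) j k.+1 * Tgen C n (i - 1) j k.+1.
Proof.
move=> h; have nz : Tgen C n i j k != 0 by apply: Tgen_neq0; lia.
by rewrite [X in X * _]/Tgen TsysSS mulfVK.
Qed.

(* Main.v *)
(** Dividing [T] by suitable functions of [i] and [j] removes the coefficients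
    lambda and mu, and turns the recurrence into the octahedron recurrence
    [X_(m+2)(r,s) X_m(r+1,s+1)
       = X_(m+1)(r,s) X_(m+1)(r+1,s+1) + X_(m+1)(r+1,s) X_(m+1)(r,s+1)].
    As in Robbins and Rumsey, [X_n(0,0)] is the sum of [X_1^A X_0^(-B)] over the
    pairs of interlacing alternating sign matrices [A] (of size n) and [B] (of
    size n-1), encoded here by their corner sums.  Hence [T_{0,0,n}] is a Laurent
    polynomial in the data, and is regular wherever no datum vanishes, even if
    the recurrence itself meets 0/0 there.

    For [lambda_a = mu_a = q^a] with [q > 0] no division by zero occurs, and one
    checks that [T_{i,j,k}] is the product over [1 <= m <= k/2] and
    [2m - k <= d <= k - 2m] of [q^i + q^(d+j)].  The identity to prove is an
    identity between Laurent polynomials in [q] true for all positive integers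
    [q], hence for all [q != 0]. *)
Require Import Defs.
From HB Require Import structures.
From mathcomp Require Import all_boot all_order all_algebra.
From mathcomp Require Import fraction mpoly complex reals boolp zify ring.
Import Order.TTheory GRing.Theory Num.Theory.
Local Open Scope ring_scope.
Set Implicit Arguments.
Unset Strict Implicit.

(** * Corner sums of alternating sign matrices and their interlacing *)

Definition mixdiff (h : nat -> nat -> int) (p q : nat) : int :=
  h p.+1 q.+1 - h p q.+1 - h p.+1 q + h p q.

(* [a r s] is the sum of the entries of an alternating sign matrix of size [k] in
   its first [r] rows and [s] columns, continued to [0 <= r, s <= n] by entries
   equal to 0; [mixdiff a] is the matrix itself. *)
Definition height_ok (n k : nat) (a : nat -> nat -> int) : Prop :=
  [/\ forall r s, (r <= n)%N -> (s <= n)%N ->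
        ~~ ((0 < r < k) && (0 < s < k))%N -> a r s = minn (minn r s) k,
      forall r s, (r < n)%N -> (s <= n)%N -> a r s <= a r.+1 s <= a r s + 1
    & forall r s, (r <= n)%N -> (s < n)%N -> a r s <= a r s.+1 <= a r s + 1].

(** With [c] of size [k.+1] and [a] of size [k], this is the Robbins-Rumsey compatibility of
    alternating sign matrices, written in corner sums. *)
Definition interlace (k : nat) (c a : nat -> nat -> int) : Prop :=
  forall r s, (r < k)%N -> (s < k)%N ->
    [/\ a r.+1 s <= c r.+1 s.+1, a r s.+1 <= c r.+1 s.+1,
        c r.+1 s.+1 <= a r.+1 s.+1 & c r.+1 s.+1 <= a r s + 1].

Definition between (n : nat) (lo hi h : nat -> nat -> int) : Prop :=
  forall r s, (r <= n)%N -> (s <= n)%N -> lo r s <= h r s <= hi r s.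

(* If [a] is a height of size [k], the heights of size [k.+1] and [k.-1]
   interlacing with it are those that can be chosen pointwise in the intervals
   below, each of which contains one or two integers. *)
Definition up_lo (k : nat) (a : nat -> nat -> int) (r s : nat) : int :=
  if ((0 < r <= k) && (0 < s <= k))%N then Num.max (a r.-1 s) (a r s.-1)
  else minn (minn r s) k.+1.
Definition up_hi (k : nat) (a : nat -> nat -> int) (r s : nat) : int :=
  if ((0 < r <= k) && (0 < s <= k))%N then Num.min (a r s) (a r.-1 s.-1 + 1)
  else minn (minn r s) k.+1.
Definition down_lo (k : nat) (a : nat -> nat -> int) (r s : nat) : int :=
  if ((0 < r < k.-1) && (0 < s < k.-1))%N
  then Num.max (a r s) (a r.+1 s.+1 - 1) else minn (minn r s) k.-1.
Definition down_hi (k : nat) (a : nat -> nat -> int) (r s : nat) : int :=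
  if ((0 < r < k.-1) && (0 < s < k.-1))%N
  then Num.min (a r.+1 s) (a r s.+1) else minn (minn r s) k.-1.

(** The unit steps of [c] come for free, since values of [a] separate neighbouring values of [c]:
    for instance [c r.+1 s.+1 <= a r.+1 s.+1 <= c r.+2 s.+1 <= a r.+1 s + 1 <= c r.+1 s.+1 + 1]. *)
Lemma up_between (n k : nat) (a c : nat -> nat -> int) :
    (k < n)%N -> height_ok n k a ->
  height_ok n k.+1 c /\ interlace k c a <->
  between n (up_lo k a) (up_hi k a) c.
Proof.
move=> kn [bd lr ls]; split=> [[[bd' lr' ls'] it] r s rn sn|bt].
  rewrite /up_lo /up_hi; case: ifPn => [|h]; last first.
    by rewrite -(bd' r s) ?lexx //; lia.
  case: r s rn sn => [|r] [|s] rn sn /= h; try lia.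
  by have [] := it r s; lia.
have cb r s : (r <= n)%N -> (s <= n)%N ->
    ~~ ((0 < r <= k) && (0 < s <= k))%N -> c r s = minn (minn r s) k.+1.
  by move=> rn sn /negPf h; have := bt r s rn sn; rewrite /up_lo /up_hi h; lia.
have ci r s : (r < k)%N -> (s < k)%N ->
    [/\ a r.+1 s <= c r.+1 s.+1, a r s.+1 <= c r.+1 s.+1,
        c r.+1 s.+1 <= a r.+1 s.+1 & c r.+1 s.+1 <= a r s + 1].
  move=> rk sk; have := bt r.+1 s.+1; rewrite /up_lo /up_hi /=.
  by case: ifPn => h /(_ ltac:(lia) ltac:(lia)) /andP[]; split; lia.
split; last by [].
split.
- by move=> r s rn sn h; apply: cb => //; lia.
- move=> r [|s] rn sn; first by rewrite !cb //; lia.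
  case: (ltnP s k) => sk; last by rewrite !cb; lia.
  case: r rn => [|r] rn.
    rewrite (cb 0%N) //; have := bd 0%N s.+1; have := bd 0%N s.
    case: (ltnP 0 k) => k0; last by lia.
    by have [] := ci 0%N s; lia.
  case: (ltnP r.+1 k) => rk.
    by have [] := ci r s; have [] := ci r.+1 s; lia.
  rewrite (cb r.+2) ?ltnS; try lia.
  case: (ltnP r k) => rk'; last by rewrite cb; lia.
  by have [] := ci r s; have := bd r.+1 s; have := bd r.+1 s.+1; lia.
- move=> [|r] s rn sn; first by rewrite !cb //; lia.
  case: (ltnP r k) => rk; last by rewrite !cb; lia.
  case: s sn => [|s] sn.
    rewrite (cb _ 0%N) //; try lia; have := bd r.+1 0%N; have := bd r 0%N.
    case: (ltnP 0 k) => k0; last by lia.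
    by have [] := ci r 0%N; lia.
  case: (ltnP s.+1 k) => sk.
    by have [] := ci r s; have [] := ci r s.+1; lia.
  rewrite (cb _ s.+2) ?ltnS; try lia.
  case: (ltnP s k) => sk'; last by rewrite cb; lia.
  by have [] := ci r s; have := bd r s.+1; have := bd r.+1 s.+1; lia.
Qed.

Lemma down_between (n k : nat) (a b : nat -> nat -> int) :
    (0 < k <= n)%N -> height_ok n k a ->
  height_ok n k.-1 b /\ interlace k.-1 a b <->
  between n (down_lo k a) (down_hi k a) b.
Proof.
case: k => // k kn [bd lr ls]; rewrite [k.+1.-1]/=.
split=> [[[bd' lr' ls'] it] r s rn sn|bt].
  rewrite /down_lo /down_hi /=; case: ifPn => [h|h]; last first.
    by rewrite -(bd' r s) ?lexx //; lia.
  have [] := it r s; try lia.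
  case: r s rn sn h => [|r] [|s] rn sn //= h; try lia.
  have [] := it r.+1 s; try lia.
  have [] := it r s.+1; try lia.
  by have [] := it r s; lia.
have cb r s : (r <= n)%N -> (s <= n)%N ->
    ~~ ((0 < r < k) && (0 < s < k))%N -> b r s = minn (minn r s) k.
  by move=> rn sn /negPf h; have := bt r s rn sn; rewrite /down_lo /down_hi h; lia.
(* Stated up to the border: there [b] is forced, and the border values and unit steps of [a] give
   the bounds. Interlacing and the unit steps of [b] both follow from these inequalities. *)
have ci r s : (r <= k)%N -> (s <= k)%N ->
    [/\ a r s <= b r s, a r.+1 s.+1 <= b r s + 1,
        b r s <= a r.+1 s & b r s <= a r s.+1].
  move=> rk sk; case h: ((0 < r < k) && (0 < s < k))%N.
    by have := bt r s; rewrite /down_lo /down_hi /= h; split; lia.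
  have := lr r s ltac:(lia) ltac:(lia); have := ls r s ltac:(lia) ltac:(lia).
  have := lr r s.+1 ltac:(lia) ltac:(lia).
  have := ls r.+1 s ltac:(lia) ltac:(lia).
  have -> : b r s = minn r s by rewrite cb; lia.
  have [r0|[s0|[rk'|sk']]] : r = 0%N \/ s = 0%N \/ r = k \/ s = k by lia.
  - by rewrite (bd r s) 1?(bd r s.+1); [split; lia|lia..].
  - by rewrite (bd r s) 1?(bd r.+1 s); [split; lia|lia..].
  - by rewrite (bd r.+1 s) 1?(bd r.+1 s.+1); [split; lia|lia..].
  - by rewrite (bd r s.+1) 1?(bd r.+1 s.+1); [split; lia|lia..].
split; last first.
  move=> r s rk sk; have [] := ci r s; try lia.
  have [] := ci r.+1 s; try lia.
  have [] := ci r s.+1; try lia.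
  have [] := ci r.+1 s.+1; try lia.
  by split; lia.
split=> //.
- move=> r s rn sn; case: (ltnP r k) => rk; last by rewrite !cb; lia.
  case: (leqP s k) => sk; last by rewrite !cb; lia.
  by have [] := ci r s; have [] := ci r.+1 s; lia.
- move=> r s rn sn; case: (ltnP s k) => sk; last by rewrite !cb; lia.
  case: (leqP r k) => rk; last by rewrite !cb; lia.
  by have [] := ci r s; have [] := ci r s.+1; lia.
Qed.

(** * Monomials indexed by a grid and their sums over heights *)

Section GridProducts.
Variables (K : fieldType) (n : nat).
Implicit Types (Y : nat -> nat -> K) (E : nat -> nat -> int).

Definition grid_prod Y E : K := \prod_(p < n) \prod_(q < n) Y p q ^ E p q.

Lemma eq_grid_prod Y E E' :
    (forall p q, (p < n)%N -> (q < n)%N -> E p q = E' p q) ->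
  grid_prod Y E = grid_prod Y E'.
Proof.
by move=> e; apply: eq_bigr => p _; apply: eq_bigr => q _; rewrite e.
Qed.

Lemma grid_prodD Y E E' : (forall p q, Y p q != 0) ->
  grid_prod Y (fun p q => E p q + E' p q) = grid_prod Y E * grid_prod Y E'.
Proof.
move=> Y0; rewrite /grid_prod -big_split; apply: eq_bigr => p _.
by rewrite -big_split; apply: eq_bigr => q _; rewrite expfzDr.
Qed.

Lemma grid_prodN Y E :
  grid_prod Y (fun p q => - E p q) = (grid_prod Y E)^-1.
Proof.
rewrite /grid_prod -prodfV; apply: eq_bigr => p _.
by rewrite -prodfV; apply: eq_bigr => q _; rewrite invr_expz.
Qed.

Lemma grid_prod_neq0 Y E : (forall p q, Y p q != 0) -> grid_prod Y E != 0.
Proof.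
move=> Y0; apply/prodf_neq0 => p _; apply/prodf_neq0 => q _.
by rewrite expfz_neq0.
Qed.

Lemma grid_prodM Y Y' E :
  grid_prod (fun p q => Y p q * Y' p q) E = grid_prod Y E * grid_prod Y' E.
Proof.
rewrite /grid_prod -big_split; apply: eq_bigr => p _.
by rewrite -big_split; apply: eq_bigr => q _; rewrite expfzMl.
Qed.

Lemma prod_shift (y : nat -> K) (e e' : nat -> int) :
    e 0%N = 0 -> (forall p, e p.+1 = e' p) -> e' n.-1 = 0 ->
  \prod_(p < n) y p ^ e p = \prod_(p < n) y p.+1 ^ e' p.
Proof.
case: n => [|m] e0 eS en; first by rewrite !big_ord0.
rewrite big_ord_recl [RHS]big_ord_recr /= e0 en !expr0z mul1r mulr1.
by apply: eq_bigr => p _; rewrite eS.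
Qed.

Lemma grid_prod_shiftr Y E E' :
    (forall p, E p 0%N = 0) -> (forall p q, E p q.+1 = E' p q) ->
    (forall p, (p < n)%N -> E' p n.-1 = 0) ->
  grid_prod Y E = grid_prod (fun p q => Y p q.+1) E'.
Proof.
move=> E0 ES En; apply: eq_bigr => p _.
by apply: (@prod_shift (Y p) (E p) (E' p)) => //; apply: En.
Qed.

Lemma grid_prod_shiftl Y E E' :
    (forall q, E 0%N q = 0) -> (forall p q, E p.+1 q = E' p q) ->
    (forall q, (q < n)%N -> E' n.-1 q = 0) ->
  grid_prod Y E = grid_prod (fun p q => Y p.+1 q) E'.
Proof.
move=> E0 ES En; rewrite /grid_prod exchange_big [RHS]exchange_big.
apply: eq_bigr => q _; apply: (@prod_shift (Y^~ q) (E^~ q) (E'^~ q)) => //.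
exact: En.
Qed.

Lemma prod_by_parts (y : nat -> K) (g : nat -> int) :
    (forall p, y p != 0) -> g 0%N = 0 -> g n = 0 ->
  \prod_(p < n) y p ^ (g p.+1 - g p) = \prod_(p < n) (y p / y p.+1) ^ g p.+1.
Proof.
move=> y0 g0 gn.
under eq_bigr do rewrite expfzDr //.
under [RHS]eq_bigr do rewrite expfzMl.
rewrite !big_split; congr (_ * _).
case: n gn => [|m] gm; first by rewrite !big_ord0.
rewrite big_ord_recl [RHS]big_ord_recr /= g0 gm oppr0 !expr0z mul1r mulr1.
by apply: eq_bigr => p _; rewrite exprz_inv.
Qed.

Definition cross_ratio Y p q : K :=
  (Y p q / Y p q.+1) / (Y p.+1 q / Y p.+1 q.+1).

(** Summation by parts in both variables, without boundary terms as [h] vanishes on the border. Thus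
    raising one inner value of a height by 1 multiplies its monomial by one cross ratio. *)
Lemma grid_prod_by_parts Y (h : nat -> nat -> int) :
    (forall p q, Y p q != 0) ->
    (forall r, (r <= n)%N -> [/\ h r 0%N = 0, h 0%N r = 0, h r n = 0 & h n r = 0]) ->
  grid_prod Y (mixdiff h) =
  grid_prod (cross_ratio Y) (fun p q => h p.+1 q.+1).
Proof.
move=> Y0 hb; transitivity (\prod_(p < n) \prod_(q < n)
    (Y p q / Y p q.+1) ^ (h p.+1 q.+1 - h p q.+1)).
  apply: eq_bigr => p _.
  have [p0 _ pn _] := hb p.+1 (ltn_ord p).
  have [p0' _ pn' _] := hb p (ltnW (ltn_ord p)).
  rewrite -(@prod_by_parts (Y p) (fun q => h p.+1 q - h p q)) ?p0 ?p0' ?pn ?pn' //.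
  by apply: eq_bigr => q _; congr (_ ^ _); rewrite /mixdiff; ring.
rewrite exchange_big [RHS]exchange_big; apply: eq_bigr => q _ /=.
have [_ q0 _ qn] := hb q.+1 (ltn_ord q).
rewrite (@prod_by_parts (fun p => Y p q / Y p q.+1) (h^~ q.+1)) // => p.
by rewrite mulf_neq0 ?invr_neq0.
Qed.

(** A finite type, so that sums over heights are ordinary finite sums; corner sums of matrices of
    size at most [n] lie in [[0, n]]. *)
Definition height := {ffun 'I_n.+1 * 'I_n.+1 -> 'I_n.+1}.
HB.instance Definition _ := Finite.on height.

Definition hval (h : height) (r s : nat) : int :=
  (h (inord r, inord s) : nat)%:Z.

(** Distributivity: the values of [h] are chosen independently, so the sum factors over the points.
    A point with two admissible values contributes 1 for [lo] and [z r s] for [lo + 1]. *)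
Lemma sum_between (lo hi : nat -> nat -> int) (F : height -> K) (F0 : K)
    (z : nat -> nat -> K) :
    (forall r s, (r <= n)%N -> (s <= n)%N ->
       (0 <= lo r s) && (lo r s <= hi r s <= lo r s + 1) && (hi r s <= n%:Z)) ->
    (forall h, between n lo hi (hval h) -> F h =
       F0 * \prod_(r < n.+1) \prod_(s < n.+1) z r s ^ (hval h r s - lo r s)) ->
  \sum_(h | `[< between n lo hi (hval h) >]) F h =
  F0 * \prod_(r < n.+1) \prod_(s < n.+1)
         (if hi r s == lo r s then 1 else 1 + z r s).
Proof.
move=> lohi Fz; under eq_bigr => h /asboolP hb do rewrite Fz // pair_big.
rewrite -big_distrr /= [in RHS]pair_big /=; congr (_ * _).
pose Q (i : 'I_n.+1 * 'I_n.+1) : pred 'I_n.+1 :=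
  fun v => lo i.1 i.2 <= v%:Z <= hi i.1 i.2.
transitivity (\sum_(h : height | h \in family Q)
    \prod_(i : 'I_n.+1 * 'I_n.+1) z i.1 i.2 ^ ((h i : nat)%:Z - lo i.1 i.2)).
  apply: eq_big => [h|h _].
    apply/asboolP/familyP => [bt [r s]|fh r s rn sn].
      have := bt r s (ltn_ord r) (ltn_ord s).
      by rewrite /hval !inord_val.
    have := fh (inord r, inord s).
    by rewrite /in_mem /= /Q /= !inordK ?ltnS.
  by apply: eq_bigr => -[r s] _; rewrite /hval /= !inord_val.
rewrite -(bigA_distr_big_dep (fun i v => v \in Q i)
  (fun i (v : 'I_n.+1) => z i.1 i.2 ^ ((v : nat)%:Z - lo i.1 i.2))).
apply: eq_bigr => -[r s] _ /=.
have := lohi r s (ltn_ord r) (ltn_ord s).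
set l := lo r s; set u := hi r s => lu.
have lN : l = (absz l)%:Z by lia.
have l_lt : (absz l < n.+1)%N by lia.
transitivity (\sum_(v < n.+1 | l <= v%:Z <= u) z r s ^ (v%:Z - l)) => //.
rewrite (bigD1 (Ordinal l_lt)) /=; last by lia.
rewrite -lN subrr expr0z; case: ifPn => [/eqP ul|ul].
  by rewrite big1 ?addr0 // => v /andP[h /eqP]; case; apply/val_inj => /=; lia.
have u_lt : ((absz l).+1 < n.+1)%N by lia.
congr (_ + _); rewrite (bigD1 (Ordinal u_lt)) /=; last first.
  by rewrite -val_eqE /=; lia.
rewrite big1 ?addr0 => [|v]; last first.
  by rewrite -!val_eqE /=; lia.
by have -> : (absz l).+1%:Z - l = 1 by lia.
Qed.

Lemma prod_border_low (G : nat -> nat -> K) :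
    (forall r, (r <= n)%N -> G r 0%N = 1 /\ G 0%N r = 1) ->
  \prod_(r < n.+1) \prod_(s < n.+1) G r s =
  \prod_(p < n) \prod_(q < n) G p.+1 q.+1.
Proof.
move=> G1; rewrite big_ord_recl big1 => [|s _]; last first.
  by have [] := G1 s (ltn_ord s).
rewrite mul1r; apply: eq_bigr => p _.
by rewrite big_ord_recl (G1 _ (ltn_ord p)).1 mul1r.
Qed.

Lemma prod_border_high (G : nat -> nat -> K) :
    (forall r, (r <= n)%N -> G r n = 1 /\ G n r = 1) ->
  \prod_(r < n.+1) \prod_(s < n.+1) G r s =
  \prod_(p < n) \prod_(q < n) G p q.
Proof.
move=> G1; rewrite big_ord_recr /= [X in _ * X]big1 => [|s _]; last first.
  by have [] := G1 s (ltn_ord s).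
rewrite mulr1; apply: eq_bigr => p _.
by rewrite big_ord_recr /= (G1 _ (ltnW (ltn_ord p))).1 mulr1.
Qed.

Lemma mixdiffD (h h' : nat -> nat -> int) p q :
  mixdiff (fun r s => h r s + h' r s) p q = mixdiff h p q + mixdiff h' p q.
Proof. by rewrite /mixdiff; ring. Qed.

Lemma mixdiffN (h : nat -> nat -> int) p q :
  mixdiff (fun r s => - h r s) p q = - mixdiff h p q.
Proof. by rewrite /mixdiff; ring. Qed.

Lemma sum_grid_prod_between Y (lo hi : nat -> nat -> int) :
    (forall p q, Y p q != 0) ->
    (forall r s, (r <= n)%N -> (s <= n)%N ->
       (0 <= lo r s) && (lo r s <= hi r s <= lo r s + 1) && (hi r s <= n%:Z)) ->
    (forall r, (r <= n)%N -> [/\ hi r 0%N = lo r 0%N, hi 0%N r = lo 0%N r,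
       hi r n = lo r n & hi n r = lo n r]) ->
  \sum_(h | `[< between n lo hi (hval h) >]) grid_prod Y (mixdiff (hval h)) =
  grid_prod Y (mixdiff lo) *
  \prod_(p < n) \prod_(q < n)
    (if hi p.+1 q.+1 == lo p.+1 q.+1 then 1 else 1 + cross_ratio Y p q).
Proof.
move=> Y0 lohi bd.
(* The truncated predecessors at [r = 0] or [s = 0] are harmless, because [hi = lo] on the
   border. *)
rewrite (@sum_between lo hi _ (grid_prod Y (mixdiff lo))
  (fun r s => cross_ratio Y r.-1 s.-1)) //.
  congr (_ * _); rewrite (@prod_border_low (fun r s =>
    if hi r s == lo r s then 1 else 1 + cross_ratio Y r.-1 s.-1)) // => r rn.
  by have [-> -> _ _] := bd r rn; rewrite !eqxx.
move=> h bt; pose d r s := hval h r s - lo r s.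
have d0 r : (r <= n)%N -> [/\ d r 0%N = 0, d 0%N r = 0, d r n = 0 & d n r = 0].
  move=> rn; have [e1 e2 e3 e4] := bd r rn; rewrite /d.
  have := bt r 0%N rn isT; have := bt 0%N r isT rn.
  have := bt r n rn (leqnn n); have := bt n r (leqnn n) rn.
  by split; lia.
rewrite (@prod_border_low (fun r s => cross_ratio Y r.-1 s.-1 ^ d r s)) /=.
  rewrite -[\prod_(p < n) _]/(grid_prod (cross_ratio Y) (fun p q => d p.+1 q.+1)).
  rewrite -grid_prod_by_parts // -grid_prodD //; apply: eq_grid_prod => p q _ _.
  by rewrite -mixdiffD /mixdiff /d; ring.
by move=> r /d0 [-> -> _ _]; rewrite !expr0z.
Qed.

(** On the border of the square the max and min formulas collapse to the forced value, so all its
    cells can be treated alike. *)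
Lemma down_loE k (a : nat -> nat -> int) p q :
    (k <= n)%N -> height_ok n k a -> (p < k)%N -> (q < k)%N ->
  down_lo k a p q = Num.max (a p q) (a p.+1 q.+1 - 1) /\
  down_hi k a p q = Num.min (a p.+1 q) (a p q.+1).
Proof.
move=> kn [bd lr ls] pk qk; rewrite /down_lo /down_hi; case: ifPn => // h.
have := lr p q ltac:(lia) ltac:(lia); have := ls p q ltac:(lia) ltac:(lia).
have := lr p q.+1 ltac:(lia) ltac:(lia).
have := ls p.+1 q ltac:(lia) ltac:(lia).
have [r0|[s0|[rk'|sk']]] : p = 0%N \/ q = 0%N \/ p = k.-1 \/ q = k.-1 by lia.
- by rewrite (bd p q) 1?(bd p q.+1); [split; lia|lia..].
- by rewrite (bd p q) 1?(bd p.+1 q); [split; lia|lia..].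
- by rewrite (bd p.+1 q) 1?(bd p.+1 q.+1); [split; lia|lia..].
- by rewrite (bd p q.+1) 1?(bd p.+1 q.+1); [split; lia|lia..].
Qed.

Definition octa Y p q : K := Y p q * Y p.+1 q.+1 + Y p.+1 q * Y p q.+1.

Lemma octa_cross_ratio Y p q : (forall r s, Y r s != 0) ->
  octa Y p q = Y p.+1 q * Y p q.+1 * (1 + cross_ratio Y p q).
Proof.
move=> Y0; rewrite /octa /cross_ratio; field.
by rewrite !Y0.
Qed.

Lemma cross_ratio_neq0 Y p q : (forall r s, Y r s != 0) ->
  cross_ratio Y p q != 0.
Proof. by move=> Y0; rewrite !mulf_neq0 ?invr_neq0 ?mulf_neq0 ?invr_neq0. Qed.

(** Inside the square the matrix entry [mixdiff a p q] is 0, 1 or -1. An entry 1 leaves two choices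
    for the larger height and one for the smaller, an entry -1 the reverse, an entry 0 one for each.
    For -1 the identity reads [w^-1 = (1 + w)^-1 * (1 + w^-1)]. Outside the square everything is
    forced. *)
Lemma cell_identity Y k (a : nat -> nat -> int) p q :
    (forall r s, Y r s != 0) -> (0 < k < n)%N -> height_ok n k a ->
    ((p < k)%N -> (q < k)%N -> octa Y p q != 0) -> (p < n)%N -> (q < n)%N ->
  let w := cross_ratio Y p q in
  w ^ (up_lo k a p.+1 q.+1 + down_lo k a p q - a p.+1 q - a p q.+1) *
    (if up_hi k a p.+1 q.+1 == up_lo k a p.+1 q.+1 then 1 else 1 + w) =
  (1 + w) ^ mixdiff a p q *
    (if down_hi k a p q == down_lo k a p q then 1 else 1 + w^-1).
Proof.
move=> Y0 kn ok N0 pn qn w.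
case pqk: ((p < k) && (q < k))%N; last first.
  have [bd _ _] := ok.
  have -> : up_hi k a p.+1 q.+1 = up_lo k a p.+1 q.+1.
    by rewrite /up_lo /up_hi !ifF; lia.
  have -> : down_hi k a p q = down_lo k a p q.
    by rewrite /down_lo /down_hi !ifF; lia.
  rewrite !eqxx !mulr1 /up_lo /down_lo /mixdiff !ifF; try lia.
  rewrite !bd; try lia.
  set e1 := (X in w ^ X); set e2 := (X in (1 + w) ^ X).
  have -> : e1 = 0 by rewrite /e1; lia.
  have -> : e2 = 0 by rewrite /e2; lia.
  by rewrite !expr0z.
case/andP: pqk => pk qk.
have w0 : w != 0 by apply: cross_ratio_neq0.
have w1 : 1 + w != 0.
  by move: (N0 pk qk); rewrite octa_cross_ratio // mulf_eq0 negb_or => /andP[].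
have kn' : (k <= n)%N by lia.
have [-> ->] := down_loE kn' ok pk qk.
have -> : up_lo k a p.+1 q.+1 = Num.max (a p q.+1) (a p.+1 q).
  by rewrite /up_lo ifT //; lia.
have -> : up_hi k a p.+1 q.+1 = Num.min (a p.+1 q.+1) (a p q + 1).
  by rewrite /up_hi ifT //; lia.
case: ok => _ lr ls.
have := lr p q ltac:(lia) ltac:(lia); have := ls p q ltac:(lia) ltac:(lia).
have := lr p q.+1 ltac:(lia) ltac:(lia).
have := ls p.+1 q ltac:(lia) ltac:(lia).
rewrite /mixdiff.
set x := a p q; set x1 := a p.+1 q; set x2 := a p q.+1; set x3 := a p.+1 q.+1.
move=> h1 h2 h3 h4.
set e1 := (X in w ^ X); set e2 := (X in (1 + w) ^ X).
have [h|[h|h]] : e2 = 0 \/ e2 = 1 \/ e2 = -1 by rewrite /e2; lia.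
- have -> : e1 = 0 by move: h; rewrite /e1 /e2; lia.
  by rewrite h !expr0z !mul1r !ifT //; move: h; rewrite /e2; lia.
- have -> : e1 = 0 by move: h; rewrite /e1 /e2; lia.
  rewrite h expr0z expr1z mul1r ifF; last by move: h; rewrite /e2; lia.
  by rewrite ifT ?mulr1 //; move: h; rewrite /e2; lia.
- have -> : e1 = -1 by move: h; rewrite /e1 /e2; lia.
  rewrite h ifT; last by move: h; rewrite /e2; lia.
  rewrite ifF; last by move: h; rewrite /e2; lia.
  rewrite !exprN1; field.
  by rewrite w1 w0.
Qed.

(* Both sums factor over the cells, so the identity reduces to
   [cell_identity] for each cell, the remaining monomials being rearranged by
   summation by parts. *)
Lemma sum_up_down Y k (a : nat -> nat -> int) :
    (forall r s, Y r s != 0) -> (0 < k < n)%N -> height_ok n k a ->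
    (forall p q, (p < k)%N -> (q < k)%N -> octa Y p q != 0) ->
  \sum_(c | `[< height_ok n k.+1 (hval c) /\ interlace k (hval c) a >])
     grid_prod Y (mixdiff (hval c)) =
  grid_prod (octa Y) (mixdiff a) *
  \sum_(b | `[< height_ok n k.-1 (hval b) /\ interlace k.-1 a (hval b) >])
     grid_prod (fun p q => Y p.+1 q.+1) (fun p q => - mixdiff (hval b) p q).
Proof.
move=> Y0 kn ok N0.
have okn : height_ok n k a by [].
case: okn => bd lr ls.
have lub r s : (r <= n)%N -> (s <= n)%N -> 0 <= a r s <= n%:Z.
  move=> rn sn; apply/andP; split.
    elim: r rn => [|r IH] rn; first by rewrite bd; lia.
    by have := lr r s rn sn; have := IH (ltnW rn); lia.
  suff : a r s <= r%:Z by lia.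
  elim: r rn => [|r IH] rn; first by rewrite bd; lia.
  by have := lr r s rn sn; have := IH (ltnW rn); lia.
have kn1 : (k < n)%N by lia.
have kn2 : (0 < k <= n)%N by lia.
rewrite (eq_bigl (fun c => `[< between n (up_lo k a) (up_hi k a) (hval c) >]));
  last by move=> c; apply/asboolP/asboolP => /(up_between _ kn1 ok).
rewrite [in RHS](eq_bigl (fun b =>
    `[< between n (down_lo k a) (down_hi k a) (hval b) >]));
  last by move=> b; apply/asboolP/asboolP => /(down_between _ kn2 ok).
rewrite sum_grid_prod_between //; first last.
- by move=> r rn; rewrite /up_lo /up_hi !ifF //; lia.
- move=> r s rn sn; rewrite /up_lo /up_hi; case: ifPn => h; last by lia.
  case: r s rn sn h => [|r] [|s] rn sn h; try lia; rewrite /=.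
  have := lr r s ltac:(lia) ltac:(lia); have := ls r s ltac:(lia) ltac:(lia).
  have := lr r s.+1 ltac:(lia) ltac:(lia).
  have := ls r.+1 s ltac:(lia) ltac:(lia).
  have := lub r s ltac:(lia) ltac:(lia).
  by have := lub r.+1 s.+1 ltac:(lia) ltac:(lia); lia.
(* Inverting and shifting [Y] absorbs the minus sign, so that [sum_grid_prod_between] applies to the
   sum over [b] as well. *)
pose V p q := (Y p.+1 q.+1)^-1.
have V0 r s : V r s != 0 by rewrite invr_neq0.
have crV p q : cross_ratio V p q = (cross_ratio Y p.+1 q.+1)^-1.
  rewrite /cross_ratio /V; field.
  by rewrite !Y0 oner_neq0.
have gpV E : grid_prod (fun p q => Y p.+1 q.+1) (fun p q => - E p q) =
    grid_prod V E.
  by apply: eq_bigr => p _; apply: eq_bigr => q _; rewrite /V exprz_inv.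
under [in RHS]eq_bigr do rewrite gpV.
rewrite sum_grid_prod_between //; first last.
- by move=> r rn; rewrite /down_lo /down_hi !ifF //; lia.
- move=> r s rn sn; rewrite /down_lo /down_hi; case: ifPn => h; last by lia.
  have := lr r s ltac:(lia) ltac:(lia); have := ls r s ltac:(lia) ltac:(lia).
  have := lr r s.+1 ltac:(lia) ltac:(lia).
  have := ls r.+1 s ltac:(lia) ltac:(lia).
  have := lub r s ltac:(lia) ltac:(lia).
  by have := lub r.+1 s ltac:(lia) ltac:(lia); lia.
pose Gb r s := if down_hi k a r s == down_lo k a r s then 1
               else 1 + (cross_ratio Y r s)^-1.
(* Reindexed from [(p.+1, q.+1)] to [(p, q)], so that both sides run over the same cells; the border
   factors involved are 1. *)
have -> : \prod_(p < n) \prod_(q < n)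
    (if down_hi k a p.+1 q.+1 == down_lo k a p.+1 q.+1 then 1
     else 1 + cross_ratio V p q) = \prod_(p < n) \prod_(q < n) Gb p q.
  transitivity (\prod_(p < n) \prod_(q < n) Gb p.+1 q.+1).
    by apply: eq_bigr => p _; apply: eq_bigr => q _; rewrite crV.
  have dE r s : ~~ ((0 < r < k.-1) && (0 < s < k.-1))%N -> Gb r s = 1.
    by move/negPf => h; rewrite /Gb /down_lo /down_hi h eqxx.
  by rewrite -prod_border_low ?prod_border_high // => r rn; split; apply: dE; lia.
(* The shifts are chosen so that [e p.+1 q.+1] is the exponent of [w] in [cell_identity]; [e]
   vanishes on the border, as summation by parts requires. *)
pose b1 r s := down_lo k a r.-1 s.-1.
pose a1 r s := a r s.-1.
pose a2 r s := a r.-1 s.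
pose e r s := up_lo k a r s + b1 r s - a1 r s - a2 r s.
have gp_b1 : grid_prod Y (mixdiff b1) = (grid_prod V (mixdiff (down_lo k a)))^-1.
  rewrite -gpV grid_prodN invrK.
  rewrite (@grid_prod_shiftr _ _ (mixdiff (fun r s => down_lo k a r.-1 s))).
  - rewrite (@grid_prod_shiftl _ _ (mixdiff (down_lo k a))) //.
    + by move=> q; rewrite /mixdiff /=; ring.
    + move=> q qn; rewrite /mixdiff /down_lo prednK ?ifF; lia.
  - by move=> p; rewrite /mixdiff /b1 /=; ring.
  - by [].
  - by move=> p pn; rewrite /mixdiff /down_lo prednK ?ifF; lia.
have gp_a1 : grid_prod Y (mixdiff a1) =
    grid_prod (fun p q => Y p q.+1) (mixdiff a).
  apply: grid_prod_shiftr => //.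
  - by move=> p; rewrite /mixdiff /a1 /=; ring.
  - by move=> p pn; rewrite /mixdiff prednK ?bd; lia.
have gp_a2 : grid_prod Y (mixdiff a2) =
    grid_prod (fun p q => Y p.+1 q) (mixdiff a).
  apply: grid_prod_shiftl => //.
  - by move=> p; rewrite /mixdiff /a2 /=; ring.
  - by move=> p pn; rewrite /mixdiff prednK ?bd; lia.
have -> : grid_prod Y (mixdiff (up_lo k a)) =
    grid_prod (cross_ratio Y) (fun p q => e p.+1 q.+1) *
    (grid_prod (fun p q => Y p.+1 q * Y p q.+1) (mixdiff a) *
     grid_prod V (mixdiff (down_lo k a))).
  rewrite grid_prodM -gp_a1 -gp_a2 -[grid_prod V _]invrK -gp_b1 -grid_prodN.
  rewrite -grid_prod_by_parts // -?grid_prodD //.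
    apply: eq_grid_prod => p q _ _.
    by rewrite -mixdiffN -!mixdiffD /mixdiff /e; ring.
  have uE r s : ~~ ((0 < r <= k) && (0 < s <= k))%N ->
    up_lo k a r s = minn (minn r s) k.+1 by rewrite /up_lo => /negPf ->.
  have dE r s : ~~ ((0 < r < k.-1) && (0 < s < k.-1))%N ->
    down_lo k a r s = minn (minn r s) k.-1 by rewrite /down_lo => /negPf ->.
  move=> r rn; rewrite /e /b1 /a1 /a2.
  by split; rewrite uE ?dE ?bd //; lia.
rewrite [grid_prod (octa Y) _](_ : _ =
  grid_prod (fun p q => Y p.+1 q * Y p q.+1) (mixdiff a) *
  grid_prod (fun p q => 1 + cross_ratio Y p q) (mixdiff a)); last first.
  rewrite -grid_prodM; apply: eq_bigr => p _; apply: eq_bigr => q _.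
  by rewrite octa_cross_ratio.
set P := grid_prod _ (mixdiff a); set Q := grid_prod V _.
set W := grid_prod (cross_ratio Y) _; set G := \prod_(p < n) _.
set N1 := grid_prod _ (mixdiff a); set G' := \prod_(p < n) _.
suff cell : W * G = N1 * G'.
  by rewrite mulrAC cell mulrC mulrACA.
rewrite /W /G /N1 /G' /grid_prod -!big_split; apply: eq_bigr => p _.
rewrite -!big_split; apply: eq_bigr => q _.
rewrite /e /Gb /b1 /a1 /a2 /=.
by rewrite cell_identity // => pk qk; apply: N0.
Qed.

End GridProducts.

(** * The Robbins-Rumsey expansion of the octahedron recurrence *)

Section Expansion.
Variables (K : fieldType) (n : nat).

(** The corner sums of the identity matrix of size [k]. *)
Definition min_height (k : nat) : height n :=
  [ffun i : 'I_n.+1 * 'I_n.+1 => inord (minn (minn i.1 i.2) k) : 'I_n.+1].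

Lemma min_heightE k r s : (r <= n)%N -> (s <= n)%N ->
  hval (min_height k) r s = minn (minn r s) k.
Proof. by move=> rn sn; rewrite /hval ffunE /= !inordK //; lia. Qed.

Lemma min_height_ok k : height_ok n k (hval (min_height k)).
Proof.
by split=> r s rn sn; rewrite !min_heightE //; lia.
Qed.

Lemma height_ok_le1 k (a : height n) :
  (k <= 1)%N -> `[< height_ok n k (hval a) >] = (a == min_height k).
Proof.
move=> k1; apply/asboolP/eqP => [[bd _ _]|->]; last exact: min_height_ok.
apply/ffunP => -[r s]; apply: val_inj.
have := bd r s (ltn_ord r) (ltn_ord s) ltac:(lia).
rewrite -(min_heightE k (ltn_ord r) (ltn_ord s)).
by rewrite /hval !inord_val => -[].
Qed.

(** The shift of [X0] matches the recurrence, which divides by [X_m(r+1,s+1)]. *)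
Definition height_sum (k : nat) (X0 X1 : nat -> nat -> K) : K :=
  \sum_(a : height n | `[< height_ok n k (hval a) >])
   \sum_(b : height n |
       `[< height_ok n k.-1 (hval b) /\ interlace k.-1 (hval a) (hval b) >])
     grid_prod n X1 (mixdiff (hval a)) *
     grid_prod n (fun p q => X0 p.+1 q.+1) (fun p q => - mixdiff (hval b) p q).

Lemma height_sum1 X0 X1 : (0 < n)%N -> height_sum 1 X0 X1 = X1 0%N 0%N.
Proof.
move=> n0; rewrite /height_sum (big_pred1 (min_height 1)); last first.
  by move=> a; rewrite height_ok_le1.
rewrite (big_pred1 (min_height 0)); last first.
  move=> b; rewrite -[RHS]height_ok_le1 //.
  by apply/asboolP/asboolP => [[]|] //.
rewrite [X in _ * X](_ : _ = 1); last first.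
  apply: big1 => p _; apply: big1 => q _.
  have pn : (p < n)%N := ltn_ord p; have qn : (q < n)%N := ltn_ord q.
  by rewrite /mixdiff !min_heightE ?minn0 //; exact: ltnW.
rewrite mulr1 /grid_prod (bigD1 (Ordinal n0)) //= (bigD1 (Ordinal n0)) //=.
have md0 p q : (p < n)%N -> (q < n)%N -> (p != 0%N) || (q != 0%N) ->
    mixdiff (hval (min_height 1)) p q = 0.
  by move=> pn qn pq; rewrite /mixdiff !min_heightE; lia.
rewrite !big1 ?mulr1.
- by rewrite /mixdiff !min_heightE.
- by move=> p p0; apply: big1 => q _; rewrite md0 ?ltn_ord ?p0.
- by move=> q q0; rewrite md0 ?ltn_ord.
Qed.

(** Substituting [X2 = octa X1 / X0] turns the monomial of [a] in [X2] into one in [octa X1] and one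
    in [X0]. By [sum_up_down] the former, times the sum over smaller [b], is a sum over larger [c];
    exchanging the sums over [a] and [c] gives the expansion one layer lower. *)
Lemma height_sumS k (X0 X1 X2 : nat -> nat -> K) :
    (forall r s, X0 r s != 0) -> (forall r s, X1 r s != 0) ->
    (forall r s, X2 r s != 0) -> (0 < k < n)%N ->
    (forall r s, (r < k)%N -> (s < k)%N ->
       X2 r s * X0 r.+1 s.+1 = octa X1 r s) ->
  height_sum k X1 X2 = height_sum k.+1 X0 X1.
Proof.
move=> nz0 nz1 nz2 kn rec.
transitivity (\sum_(a : height n | `[< height_ok n k (hval a) >])
   \sum_(c : height n |
       `[< height_ok n k.+1 (hval c) /\ interlace k (hval c) (hval a) >])
     grid_prod n X1 (mixdiff (hval c)) *
     grid_prod n (fun p q => X0 p.+1 q.+1) (fun p q => - mixdiff (hval a) p q)).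
  apply: eq_bigr => a /asboolP ok.
  rewrite -big_distrr -big_distrl /= sum_up_down //; last first.
    by move=> p q pk qk; rewrite -rec // mulf_neq0.
  rewrite mulrAC; congr (_ * _); rewrite grid_prodN.
  apply/(canRL (mulfK _)); first by apply: grid_prod_neq0.
  rewrite -grid_prodM; apply: eq_bigr => p _; apply: eq_bigr => q _.
  have pn : (p < n)%N := ltn_ord p; have qn : (q < n)%N := ltn_ord q.
  (* The recurrence is available only for [p, q < k]; elsewhere the exponents are 0. *)
  case: (ltnP p k) => pk; last first.
    suff -> : mixdiff (hval a) p q = 0 by rewrite !expr0z.
    by case: ok => bd _ _; rewrite /mixdiff !bd; lia.
  case: (ltnP q k) => qk; last first.
    suff -> : mixdiff (hval a) p q = 0 by rewrite !expr0z.
    by case: ok => bd _ _; rewrite /mixdiff !bd; lia.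
  by rewrite rec.
rewrite (exchange_big_dep (fun c : height n => `[< height_ok n k.+1 (hval c) >]))
  /=; last by move=> a c _ /asboolP[okc _]; apply/asboolP.
apply: eq_bigr => c /asboolP okc; apply: eq_bigl => a.
apply/andP/asboolP => [[/asboolP ok /asboolP[_ i]]|[ok i]] //.
by split; apply/asboolP.
Qed.

(** Induction on [k] with the top layer [m + k] fixed: [height_sumS] trades the base layers
    [m.+1, m.+2] for [m, m.+1]. *)
Lemma octahedron_expansion (X : nat -> nat -> nat -> K) :
    (forall m r s, X m r s != 0) ->
    (forall m r s, (m.+2 + r <= n)%N -> (m.+2 + s <= n)%N ->
       X m.+2 r s * X m r.+1 s.+1 = octa (X m.+1) r s) ->
  forall k m, (0 < k)%N -> (m + k <= n)%N ->
    X (m + k)%N 0%N 0%N = height_sum k (X m) (X m.+1).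
Proof.
move=> nz rec; elim=> // -[|k] IH m _ mkn.
  by rewrite addn1 height_sum1 //; lia.
rewrite addnS -addSn IH //; try lia.
apply: height_sumS => //; try lia.
by move=> r s rk sk; apply: rec; lia.
Qed.

(** Only layers 0 and 1 are inverted in the expansion, so sums and products suffice. The intended
    [S] is the set of rational functions regular at a point. *)
Lemma octahedron_laurent (X : nat -> nat -> nat -> K) (S : K -> Prop) :
    S 0 -> S 1 -> (forall x y, S x -> S y -> S (x + y)) ->
    (forall x y, S x -> S y -> S (x * y)) ->
    (forall m r s, X m r s != 0) ->
    (forall m r s, (m.+2 + r <= n)%N -> (m.+2 + s <= n)%N ->
       X m.+2 r s * X m r.+1 s.+1 = octa (X m.+1) r s) ->
    (forall m r s, (m <= 1)%N -> S (X m r s) /\ S (X m r s)^-1) ->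
  (0 < n)%N -> S (X n 0%N 0%N).
Proof.
move=> S0 S1 SD SM nz rec S01 n0.
have Sexp x : S x -> S x^-1 -> forall e : int, S (x ^ e).
  move=> Sx Sx'; have Sn y m : S y -> S (y ^+ m).
    by move=> Sy; elim: m => [|m IH]; rewrite ?expr0 // exprS; apply: SM.
  by case=> m; [apply: Sn | rewrite NegzE -exprz_inv; apply: Sn].
have Sgp Y E : (forall p q, S (Y p q) /\ S (Y p q)^-1) -> S (grid_prod n Y E).
  move=> SY; apply: (big_ind S) => // p _; apply: (big_ind S) => // q _.
  by have [Sy Sy'] := SY p q; apply: Sexp.
rewrite -[n in X n]add0n (octahedron_expansion nz rec) //.
apply: (big_ind S) => // a _; apply: (big_ind S) => // b _.
by apply: SM; apply: Sgp => p q; apply: S01.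
Qed.

End Expansion.

(** * Removing the coefficients lambda and mu *)

(* A solution of [f (t + 2) f t l_(t + 1) = f (t + 1) ^ 2]: dividing [T] by
   such functions of [i] and of [j] removes the coefficients lambda and mu. *)
Fixpoint gauge (K : fieldType) (l : nat -> K) (t : nat) : K :=
  match t with
  | 0 => 1
  | 1 => 1
  | (t'.+1 as t1).+1 => gauge l t1 ^+ 2 / (l t1 * gauge l t')
  end.

Lemma gaugeSS (K : fieldType) (l : nat -> K) t :
  gauge l t.+2 = gauge l t.+1 ^+ 2 / (l t.+1 * gauge l t).
Proof. by []. Qed.

Lemma gauge_neq0 (K : fieldType) (l : nat -> K) t :
  (forall u, l u != 0) -> gauge l t != 0.
Proof.
move=> l0; elim/ltn_ind: t => -[|[|t]] IH; try exact: oner_neq0.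
by rewrite gaugeSS mulf_neq0 ?expf_neq0 ?invr_neq0 ?mulf_neq0 ?IH.
Qed.

Lemma gaugeP (K : fieldType) (l : nat -> K) t : (forall u, l u != 0) ->
  l t.+1 * (gauge l t.+2 * gauge l t) = gauge l t.+1 ^+ 2.
Proof.
move=> l0; rewrite gaugeSS; field.
by rewrite gauge_neq0 // l0.
Qed.

(** Here [g, g1, g2] and [h, h1, h2] are consecutive gauge values in the directions [i] and [j];
    solving for [l] and [k] makes the coefficients cancel. *)
Lemma gauge_octahedron (K : fieldType) (g g1 g2 h h1 h2 l k a b c d S T : K) :
    l * (g2 * g) = g1 ^+ 2 -> k * (h2 * h) = h1 ^+ 2 ->
    [/\ g != 0, g1 != 0 & g2 != 0] -> [/\ h != 0, h1 != 0 & h2 != 0] ->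
    S * T = k * a * b + l * c * d ->
  S / (g1 * h1) * (T / (g1 * h1)) =
  b / (g1 * h) * (a / (g1 * h2)) + d / (g * h1) * (c / (g2 * h1)).
Proof.
move=> gP hP [g0 g10 g20] [h0 h10 h20] rec.
have -> : S / (g1 * h1) * (T / (g1 * h1)) = (S * T) / (g1 ^+ 2 * h1 ^+ 2).
  by field; rewrite g10 h10.
rewrite rec.
have -> : k = h1 ^+ 2 / (h2 * h) by rewrite -hP; field; rewrite h0 h20.
have -> : l = g1 ^+ 2 / (g2 * g) by rewrite -gP; field; rewrite g0 g20.
field.
by rewrite g0 g10 g20 h0 h10 h20.
Qed.

(** * Regularity of [T_{0,0,n}] where no datum vanishes *)

Section Regularity.
Variables (C : numFieldType) (n : nat) (A : 'M[C]_n) (lam mu : int -> C).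
Hypotheses (A0 : forall r c, A r c != 0) (lam0 : forall a, lam a != 0)
  (mu0 : forall a, mu a != 0).

Let x := data_point A lam mu.

(** The units of the local ring at the data point [x]. *)
Definition regular_unit (f : genfrac C n) : Prop :=
  exists2 v, v != 0 & specializes x f v.

Lemma specializes1 : specializes x (1 : genfrac C n) 1.
Proof.
by have := specializes_tofrac x 1; rewrite tofrac1 meval1.
Qed.

Lemma regular_unit1 : regular_unit 1.
Proof. by exists 1; [apply: oner_neq0 | apply: specializes1]. Qed.

Lemma regular_unitM f g :
  regular_unit f -> regular_unit g -> regular_unit (f * g).
Proof.
move=> [v v0 sf] [w w0 sg]; exists (v * w); first by rewrite mulf_neq0.
exact: specializesM.
Qed.

Lemma regular_unitV f : regular_unit f -> regular_unit f^-1.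
Proof.
move=> [v v0 sf]; exists v^-1; first by rewrite invr_neq0.
exact: specializesV.
Qed.

Lemma regular_unit_neq0 f : regular_unit f -> f != 0.
Proof. by move=> [v v0 sf]; apply: specializes_neq0 sf v0. Qed.

Lemma regular_unit_gen (d : datum n) : regular_unit (gen C d).
Proof.
exists (datum_val A lam mu d); last exact: specializes_gen.
by case: d => [[r c]|[a|a]] /=.
Qed.

Lemma regular_unit_gauge l t :
  (forall u, regular_unit (l u)) -> regular_unit (gauge l t).
Proof.
move=> ul; elim/ltn_ind: t => -[|[|t]] IH; try exact: regular_unit1.
rewrite gaugeSS expr2; apply: regular_unitM.
  by apply: regular_unitM; apply: IH.
by apply: regular_unitV; apply: regular_unitM => //; apply: IH; rewrite ltnS.
Qed.

Let L (t : nat) : genfrac C n := gen_lam C n (t%:Z - n%:Z).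
Let M (t : nat) : genfrac C n := gen_mu C n (t%:Z - n%:Z).

(* [block m r s] is, up to the gauge, the value of [T] attached to the
   contiguous [m * m] block of the matrix whose top left entry is [(r, s)]. *)
Definition block (m r s : nat) : genfrac C n :=
  if ((m + r <= n) && (m + s <= n))%N then
    Tgen C n (s%:Z - r%:Z) ((r + s + m)%N%:Z - n%:Z) m /
    (gauge L (s + n - r) * gauge M (r + s + m))
  else 1.

Let L0 t : L t != 0.
Proof. exact/regular_unit_neq0/regular_unit_gen. Qed.

Let M0 t : M t != 0.
Proof. exact/regular_unit_neq0/regular_unit_gen. Qed.

Lemma block_neq0 m r s : block m r s != 0.
Proof.
rewrite /block; case: ifPn => [rs|_]; last exact: oner_neq0.
apply: mulf_neq0; first by apply: Tgen_neq0; lia.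
by apply/invr_neq0/mulf_neq0; [exact: gauge_neq0 L0 | exact: gauge_neq0 M0].
Qed.

Lemma block_octahedron m r s : (m.+2 + r <= n)%N -> (m.+2 + s <= n)%N ->
  block m.+2 r s * block m r.+1 s.+1 = octa (block m.+1) r s.
Proof.
move=> rn sn; rewrite /octa /block !ifT; try lia.
(* The outer block and the central one share the position [(i, j)]; the four blocks of size [m.+1]
   sit at [j - 1], [j + 1], [i - 1] and [i + 1]. The gauge indices [t.+1] and [u.+1] are [i + n] and
   [j + n]. *)
pose i : int := s%:Z - r%:Z; pose j : int := (r + s + m.+2)%N%:Z - n%:Z.
pose t := (s + n - r).-1; pose u := (r + s + m.+1)%N.
have -> : s%:Z - r.+1%:Z = i - 1 by rewrite /i; lia.
have -> : s.+1%:Z - r%:Z = i + 1 by rewrite /i; lia.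
have -> : s.+1%:Z - r.+1%:Z = i by rewrite /i; lia.
have -> : (r + s + m.+1)%N%:Z - n%:Z = j - 1 by rewrite /j; lia.
have -> : (r.+1 + s.+1 + m.+1)%N%:Z - n%:Z = j + 1 by rewrite /j; lia.
have -> : (r.+1 + s + m.+1)%N%:Z - n%:Z = j by rewrite /j; lia.
have -> : (r + s.+1 + m.+1)%N%:Z - n%:Z = j by rewrite /j; lia.
have -> : (r.+1 + s.+1 + m)%N%:Z - n%:Z = j by rewrite /j; lia.
rewrite -/i -/j.
have -> : (s + n - r = t.+1)%N by rewrite /t; lia.
have -> : (s.+1 + n - r.+1 = t.+1)%N by rewrite /t; lia.
have -> : (s.+1 + n - r = t.+2)%N by rewrite /t; lia.
have -> : (s + n - r.+1 = t)%N by rewrite /t; lia.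
have -> : (r + s + m.+2 = u.+1)%N by rewrite /u; lia.
have -> : (r.+1 + s.+1 + m.+1 = u.+2)%N by rewrite /u; lia.
have -> : (r.+1 + s + m.+1 = u.+1)%N by rewrite /u; lia.
have -> : (r + s.+1 + m.+1 = u.+1)%N by rewrite /u; lia.
have -> : (r.+1 + s.+1 + m = u.+1)%N by rewrite /u; lia.
rewrite -/u; apply: (@gauge_octahedron _ _ _ _ _ _ _ (L t.+1) (M u.+1)).
- exact: gaugeP L0.
- exact: gaugeP M0.
- by split; exact: gauge_neq0 L0.
- by split; exact: gauge_neq0 M0.
rewrite Tgen_recurrence; last by rewrite /i /j; lia.
have -> : gen_mu C n j = M u.+1 by rewrite /M; congr gen_mu; rewrite /j /u; lia.
have -> // : gen_lam C n i = L t.+1.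
by rewrite /L; congr gen_lam; rewrite /i /t; lia.
Qed.

(** Layers 0 and 1 of [block] are units at [x], so the expansion makes [block n 0 0] regular there;
    restoring the gauge multiplies it by a unit. *)
Lemma Tgen_regular : (0 < n)%N -> exists v, specializes x (Tgen C n 0 0 n) v.
Proof.
move=> n0; pose S (f : genfrac C n) := exists v, specializes x f v.
have SU f : regular_unit f -> S f by move=> [v _ sf]; exists v.
have SM f g : S f -> S g -> S (f * g).
  by move=> [v sf] [w sg]; exists (v * w); apply: specializesM.
have uT : S (block n 0 0).
  apply: (@octahedron_laurent _ n block S); last exact: n0.
  - by exists 0; have := specializes_tofrac x 0; rewrite tofrac0 meval0.
  - exact/SU/regular_unit1.
  - by move=> f g [v sf] [w sg]; exists (v + w); apply: specializesD.
  - exact: SM.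
  - exact: block_neq0.
  - exact: block_octahedron.
  move=> m r s m1; suff ub : regular_unit (block m r s).
    by split; apply: SU => //; apply: regular_unitV.
  rewrite /block; case: ifPn => _; last exact: regular_unit1.
  apply: regular_unitM; last first.
    apply/regular_unitV/regular_unitM; apply: regular_unit_gauge => t;
      exact: regular_unit_gen.
  case: m m1 => [|[|//]] _; first exact: regular_unit1.
  rewrite /Tgen /= /entry.
  case: insub => [r'|]; last exact: regular_unit1.
  case: insub => [c'|]; last exact: regular_unit1.
  by rewrite mxE; apply: regular_unit_gen.
have -> : Tgen C n 0 0 n = block n 0 0 * (gauge L n * gauge M n).
  rewrite /block !addn0 leqnn [true && true]/= !add0n subn0 !subrr mulfVK //.
  by apply: mulf_neq0; [exact: gauge_neq0 L0 | exact: gauge_neq0 M0].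
apply: SM => //; apply: SU; apply: regular_unitM; apply: regular_unit_gauge => t;
  exact: regular_unit_gen.
Qed.

End Regularity.

(** * The closed form for [lambda_a = mu_a = q^a] *)

Section ClosedForm.
Variables (K : fieldType) (q : K).
Hypothesis q0 : q != 0.

Fixpoint layer (l : nat) (x y : K) : K :=
  if l is l'.+1 then
    layer l' x y * ((x + q ^+ l * y) * (x + q ^- l * y))
  else x + y.

(** The value of [T_{i,j,k}] at [x = q^i], [y = q^j]: shifts of [i] and [j] become scalings of [x]
    and [y] by [q] or its inverse. *)
Fixpoint layers (k : nat) (x y : K) : K :=
  match k with
  | k'.+2 => layer k' x y * layers k' x y
  | _ => 1
  end.

Lemma layersSS k x y : layers k.+2 x y = layer k x y * layers k x y.
Proof. by []. Qed.

Lemma layerS l x y :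
  layer l.+1 x y = layer l x y * ((x + q ^+ l.+1 * y) * (x + q ^- l.+1 * y)).
Proof. by []. Qed.

(** As [layer l] has a factor [x + q^d y] for each [d] in [[-l, l]], the left side has the exponents
    [[-l, l+2]] and [[-l-2, l]], which regroup as [[-l-2, l+2]] and [[-l, l]]. *)
Lemma layer_shift l x y :
  layer l.+1 x (q * y) * layer l.+1 x (y / q) = layer l.+2 x y * layer l x y.
Proof.
elim: l => [|l IH]; first by rewrite /= !expr1 !expr2; field.
rewrite [layer l.+2 x (q * y)]layerS [layer l.+2 x (y / q)]layerS.
rewrite mulrACA IH [layer l.+3 x y]layerS [layer l.+1 x y]layerS [RHS]mulrACA.
congr (_ * _); rewrite !exprS; field.
by rewrite q0 expf_neq0.
Qed.

(** Applying [layer_shift] to successive layers leaves only the innermost factor [x + y]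
    unmatched. *)
Lemma layers_shift k x y :
  (x + y) * (layers k.+1 x (q * y) * layers k.+1 x (y / q)) =
  layers k.+2 x y * layers k x y.
Proof.
elim/ltn_ind: k => -[|[|k]] IH; first by rewrite /=; ring.
  by rewrite /= !expr1; field.
rewrite [layers k.+3 x (q * y)]layersSS [layers k.+3 x (y / q)]layersSS.
rewrite [X in _ * X = _]mulrACA layer_shift [LHS]mulrCA IH //.
by rewrite !layersSS; ring.
Qed.

Lemma layer_scale l x y c : c != 0 ->
  layer l (c * x) (c * y) = c ^+ l.*2.+1 * layer l x y.
Proof.
move=> c0; elim: l => [|l IH]; first by rewrite /= expr1 mulrDr.
by rewrite !layerS IH doubleS !exprS; ring.
Qed.

Fixpoint layers_deg (k : nat) : nat :=
  match k with k'.+2 => k'.*2.+1 + layers_deg k' | _ => 0 end.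

Lemma layers_scale k x y c : c != 0 ->
  layers k (c * x) (c * y) = c ^+ layers_deg k * layers k x y.
Proof.
move=> c0; elim/ltn_ind: k => -[|[|k]] IH; try by rewrite /= expr0 mul1r.
by rewrite !layersSS [layers_deg _]/= exprD layer_scale // IH //; ring.
Qed.

(** By homogeneity, scaling [x] by [q] amounts to scaling [y] by its inverse, up to a power of [q].
    These powers cancel, so both products agree and the left side is [x + y] times one of them. *)
Lemma layers_octahedron k x y :
  (y * layers k.+1 x (q * y) * layers k.+1 x (y / q) +
   x * layers k.+1 (q * x) y * layers k.+1 (x / q) y) =
  layers k.+2 x y * layers k x y.
Proof.
have e1 : layers k.+1 (q * x) y = q ^+ layers_deg k.+1 * layers k.+1 x (y / q).
  by rewrite -layers_scale // mulrCA divff // mulr1.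
have e2 : q ^+ layers_deg k.+1 * layers k.+1 (x / q) y = layers k.+1 x (q * y).
  by rewrite -layers_scale // mulrCA divff // mulr1.
by rewrite e1 -layers_shift -e2; ring.
Qed.

Lemma Tsys_closed_form (n : nat) :
    (forall k (i j : int), layers k (q ^ i) (q ^ j) != 0) ->
  forall k (i j : int),
    Tsys (const_mx 1 : 'M[K]_n) (fun a : int => q ^ a) (fun b : int => q ^ b)
      i j k = layers k (q ^ i) (q ^ j).
Proof.
move=> nz k; elim/ltn_ind: k => -[|[|k]] IH i j //.
  by rewrite /= /entry; case: insub => [r|//]; case: insub => [c|//]; rewrite mxE.
rewrite TsysSS !IH // !expfzDr // !exprN1 expr1z.
by rewrite ![_ * q]mulrC layers_octahedron mulfK.
Qed.

End ClosedForm.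

Lemma layerE (K : fieldType) (q : K) (l : nat) :
  layer q l 1 1 = \prod_(j <- zrange (- l%:Z) l%:Z) (1 + q ^ j).
Proof.
elim: l => [|l IH].
  by rewrite /zrange /= big_cons big_nil expr0z mulr1.
rewrite layerS IH !mulr1.
have -> : \prod_(j <- zrange (- l.+1%:Z) l.+1%:Z) (1 + q ^ j) =
  \prod_(j <- - l.+1%:Z :: l.+1%:Z :: zrange (- l%:Z) l%:Z) (1 + q ^ j).
  apply: perm_big; apply: uniq_perm; rewrite ?zrange_uniq //.
    by rewrite /= !inE !mem_zrange !zrange_uniq; lia.
  by move=> j; rewrite mem_zrange 2!in_cons mem_zrange; lia.
by rewrite !big_cons exprnN -exprnP; ring.
Qed.

Lemma layersE (K : fieldType) (q : K) (n : nat) :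
  layers q n 1 1 = \prod_(1 <= m < (n./2).+1)
    \prod_(j <- zrange (2 * m%:Z - n%:Z) (n%:Z - 2 * m%:Z)) (1 + q ^ j).
Proof.
elim/ltn_ind: n => -[|[|n]] IH; try by rewrite big_geq.
rewrite layersSS IH // layerE [RHS]big_ltn //=; congr (_ * _).
  by apply: congr_big => //; congr zrange; lia.
rewrite [RHS]big_add1 /=; apply: eq_bigr => m _.
by apply: congr_big => //; congr zrange; lia.
Qed.


(** * Laurent polynomial functions of [q] *)

Section LaurentFunctions.
Variable C : numFieldType.

Definition laurent_fun (g : C -> C) : Prop :=
  exists (p : {poly C}) (m : nat), forall t, t != 0 -> g t * t ^+ m = p.[t].

Lemma laurent_cst c : laurent_fun (fun=> c).
Proof. by exists c%:P, 0%N => t _; rewrite hornerC expr0 mulr1. Qed.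

Lemma laurentD f g :
  laurent_fun f -> laurent_fun g -> laurent_fun (fun t => f t + g t).
Proof.
move=> [p [m hp]] [r [k hr]]; exists (p * 'X^k + r * 'X^m), (m + k)%N => t t0.
by rewrite !hornerE -hp // -hr // exprD; ring.
Qed.

Lemma laurentM f g :
  laurent_fun f -> laurent_fun g -> laurent_fun (fun t => f t * g t).
Proof.
move=> [p [m hp]] [r [k hr]]; exists (p * r), (m + k)%N => t t0.
by rewrite hornerM -hp // -hr // exprD mulrACA.
Qed.

Lemma laurent_exp (a : int) : laurent_fun (fun t => t ^ a).
Proof.
case: a => m; first by exists 'X^m, 0%N => t _; rewrite hornerXn expr0 mulr1.
exists 1, m.+1 => t t0.
by rewrite hornerC NegzE -exprnN mulVf // expf_neq0.
Qed.

Lemma eq_laurent f g : f =1 g -> laurent_fun f -> laurent_fun g.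
Proof. by move=> e [p [m hp]]; exists p, m => t; rewrite -e; apply: hp. Qed.

Lemma laurent_sum (I : Type) (r : seq I) (F : I -> C -> C) :
    (forall i, laurent_fun (F i)) ->
  laurent_fun (fun t => \sum_(i <- r) F i t).
Proof.
move=> lF; elim: r => [|i r IH].
  by apply: eq_laurent (laurent_cst 0) => t; rewrite big_nil.
by apply: eq_laurent (laurentD (lF i) IH) => t; rewrite big_cons.
Qed.

Lemma laurent_prod (I : Type) (r : seq I) (F : I -> C -> C) :
    (forall i, laurent_fun (F i)) ->
  laurent_fun (fun t => \prod_(i <- r) F i t).
Proof.
move=> lF; elim: r => [|i r IH].
  by apply: eq_laurent (laurent_cst 1) => t; rewrite big_nil.
by apply: eq_laurent (laurentM (lF i) IH) => t; rewrite big_cons.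
Qed.

Lemma laurent_meval (N : nat) (x : C -> 'I_N -> C) (p : {mpoly C[N]}) :
    (forall i, laurent_fun (fun t => x t i)) ->
  laurent_fun (fun t => p.@[x t]).
Proof.
move=> lx; apply: (@eq_laurent (fun t =>
  \sum_(m <- msupp p) p@_m * \prod_(i < N) x t i ^+ m i)).
  by move=> t; rewrite mevalE.
apply: laurent_sum => m; apply: laurentM; first exact: laurent_cst.
apply: laurent_prod => i; elim: (m i) => [|k IH].
  by apply: eq_laurent (laurent_cst 1) => t; rewrite expr0.
by apply: eq_laurent (laurentM (lx i) IH) => t; rewrite exprS.
Qed.

(** In characteristic 0 the positive integers are distinct, so the numerator has more roots than its
    degree allows. *)
Lemma laurent_eq0 f t : laurent_fun f ->
  (forall m : nat, f m.+1%:R = 0) -> t != 0 -> f t = 0.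
Proof.
move=> [p [k hp]] f0 t0.
have p0 : p = 0.
  apply: (@roots_geq_poly_eq0 _ p [seq m.+1%:R | m <- iota 0 (size p)]).
  - apply/allP => _ /mapP[m _ ->].
    by rewrite /root -hp ?f0 ?mul0r // pnatr_eq0.
  - rewrite map_inj_uniq ?iota_uniq // => a b /eqP.
    by rewrite eqr_nat eqSS => /eqP.
  - by rewrite size_map size_iota.
have := hp t t0; rewrite p0 horner0 => /eqP.
by rewrite mulf_eq0 expf_eq0 (negPf t0) andbF orbF => /eqP.
Qed.

End LaurentFunctions.

(** * From positive [q] to all nonzero [q] *)

Lemma layer_gt0 (C : numFieldType) (q x y : C) l :
  0 < q -> 0 < x -> 0 < y -> 0 < layer q l x y.
Proof.
move=> q0 x0 y0; elim: l => [|l IH]; first by rewrite /= addr_gt0.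
by rewrite layerS !mulr_gt0 ?addr_gt0 ?mulr_gt0 ?invr_gt0 ?exprn_gt0.
Qed.

Lemma layers_gt0 (C : numFieldType) (q x y : C) k :
  0 < q -> 0 < x -> 0 < y -> 0 < layers q k x y.
Proof.
move=> q0 x0 y0; elim/ltn_ind: k => -[|[|k]] IH; try exact: ltr01.
by rewrite layersSS mulr_gt0 ?layer_gt0 ?IH.
Qed.

Lemma is_lambda_det_pos (C : numFieldType) (n : nat) (q : C) : 0 < q ->
  is_lambda_det (const_mx 1 : 'M[C]_n) (fun a : int => q ^ a)
    (fun b : int => q ^ b) (layers q n 1 1).
Proof.
move=> q0; have qn0 : q != 0 by rewrite gt_eqF.
have nz k (i j : int) : layers q k (q ^ i) (q ^ j) != 0.
  by rewrite gt_eqF // layers_gt0 ?exprz_gt0.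
have TE := Tsys_closed_form qn0 n nz.
have := TE n 0 0; rewrite !expr0z => <-.
by apply: is_lambda_det_direct => i j k _; rewrite TE.
Qed.

(** Cross-multiplied, a fixed fraction for [f] can be evaluated even at points where its denominator
    vanishes. *)
Lemma specializes_num (C : fieldType) (N : nat) (y : 'I_N -> C)
    (f : {fraction {mpoly C[N]}}) (num den : {mpoly C[N]}) (v : C) :
    den != 0 -> f = FracField.tofrac num / FracField.tofrac den ->
  specializes y f v -> v * den.@[y] = num.@[y].
Proof.
move=> den0 fE sf.
have := specializesM sf (specializes_tofrac y den).
rewrite fE mulfVK ?tofrac_eq0 // => sn.
exact: specializes_unique sn (specializes_tofrac y num).
Qed.

Theorem theorem3p6 (R : realType) (n : nat) (q : R[i]) (hn : (1 <= n)%N)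
    (hq : q != 0) :
  is_lambda_det (const_mx 1 : 'M[R[i]]_n) (fun a : int => q ^ a)
    (fun b : int => q ^ b)
    (\prod_(1 <= m < (n./2).+1)
       \prod_(j <- zrange (2 * m%:Z - n%:Z) (n%:Z - 2 * m%:Z)) (1 + q ^ j)).
Proof.
pose C : numFieldType := R[i].
pose x (t : C) :=
  data_point (const_mx 1 : 'M[C]_n) (fun a : int => t ^ a) (fun b : int => t ^ b).
(* Regularity at the given [q] provides a fraction whose denominator is nonzero there; only its
   value remains to be found. *)
have [||| v [num [den [den0 Tnd _]]]] := @Tgen_regular C n (const_mx 1)
  (fun a : int => q ^ a) (fun b : int => q ^ b) _ _ _ hn.
- by move=> r c; rewrite mxE oner_neq0.
- by move=> a; rewrite expfz_neq0.
- by move=> a; rewrite expfz_neq0.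
exists num, den; split=> //.
rewrite -layersE; apply: (canRL (mulfK den0)).
have lx i : laurent_fun (fun t => x t i).
  rewrite /x /data_point; case: (enum_val i) => [[r c]|[a|a]] /=.
  - by apply: eq_laurent (laurent_cst 1) => t; rewrite mxE.
  - exact: laurent_exp.
  - exact: laurent_exp.
(* The claim at parameter [t], cleared of the denominator. It is Laurent in [t] and vanishes at
   positive integers by [is_lambda_det_pos], whether or not [den] vanishes there. *)
pose g t := layers t n 1 1 * den.@[x t] + (-1) * num.@[x t].
have lg : laurent_fun g.
  apply: laurentD; apply: laurentM; try exact: laurent_meval.
    apply: (@eq_laurent _ (fun t => \prod_(1 <= m < (n./2).+1)
      \prod_(j <- zrange (2 * m%:Z - n%:Z) (n%:Z - 2 * m%:Z)) (1 + t ^ j))).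
      by move=> t; rewrite -layersE.
    apply: laurent_prod => m; apply: laurent_prod => j.
    by apply: laurentD; [apply: laurent_cst | apply: laurent_exp].
  exact: laurent_cst.
suff : g q = 0 by rewrite /g mulN1r => /eqP; rewrite subr_eq0 => /eqP.
apply: laurent_eq0 hq => // m; rewrite /g mulN1r.
have sT := is_lambda_det_pos n (ltr0Sn C m).
have den_neq0 : den != 0 by apply: contraNneq den0 => ->; rewrite meval0.
by rewrite (specializes_num den_neq0 Tnd sT) subrr.
Qed.
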